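(* Let $n\ge2$ and $k,d\ge1$. The groups $\mathrm{RFA}(\mathbb{Z}^d,n,k)$ and $\mathrm{RTM}(\mathbb{Z}^d,n,k)$ contain (a subgroup isomorphic to) the free group on two elements. In particular, they are not amenable.
   Context: Let $\Sigma=\{0,\dots,n-1\}$, $Q=\{1,\dots,k\}$. Let $X_k=\{y\in\{0,1,\dots,k\}^{\mathbb{Z}^d} : y_{\vec u}\ne0\text{ and }y_{\vec v}\neq 0\implies \vec u=\vec v\}$ and $X_{n,k}=\Sigma^{\mathbb{Z}^d}\times X_k$. Given finite $F,F'\subset\mathbb{Z}^d$ and $f:\Sigma^F\times Q\to\Sigma^{F'}\times Q\times\mathbb{Z}^d$ (a local rule), the map $T_f:X_{n,k}\to X_{n,k}$ is defined by: $T_f(x,y)=(x,y)$ if $y$ is identically $0$; otherwise let $\vec v$ be the unique position with $q=y_{\vec v}\ne 0$, let $p\in\Sigma^F$ with $p_{\vec u}=x_{\vec v+\vec u}$, and $f(p,q)=(p',q',\vec e)$; then $T_f(x,y)=(\tilde x,\tilde y)$ with $\tilde x_{\vec t}=p'_{\vec t-\vec v}$ if $\vec t-\vec v\in F'$, $\tilde x_{\vec t}=x_{\vec t}$ otherwise, and $\tilde y_{\vec v+\vec e}=q'$, $\tilde y_{\vec t}=0$ for $\vec t\ne\vec v+\vec e$. Such maps are the $(d,n,k)$-Turing machines; one is reversible if it has a two-sided inverse that is a $(d,n,k)$-Turing machine. The reversible ones form the group $\mathrm{RTM}(\mathbb{Z}^d,n,k)$ under composition. $\mathrm{RFA}(\mathbb{Z}^d,n,k)$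 is the subgroup of reversible $(d,n,k)$-Turing machines that do not change the tape, i.e. that have a local rule $f:\Sigma^F\times Q\to\Sigma^F\times Q\times\mathbb{Z}^d$ of the form $f(p,q)=(p,q',\vec z)$ for all $p\in\Sigma^F,q\in Q$ (with $q',\vec z$ depending on $p,q$). *)

(* Defs.v *)
From HB Require Import structures.
From mathcomp Require Import all_boot all_algebra.
From mathcomp Require Import finmap.
From mathcomp Require Import boolp classical_sets reals.

Set Implicit Arguments.
Unset Strict Implicit.
Unset Printing Implicit Defensive.

Import GRing.Theory.

Local Open Scope group_scope.

(* The free group on A: reduced words over the letters (a, false), read as a,
   and (a, true), read as a^-1. *)
Section FreeGroup.
Variable A : choiceType.
Implicit Types (l m : A * bool) (u v w : seq (A * bool)).

Definition letter_inv l := (l.1, ~~ l.2).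

Definition reduced w := sorted (fun l m => m != letter_inv l) w.

(* left multiplication of a reduced word by one letter *)
Definition push l w :=
  if w is m :: w' then if m == letter_inv l then w' else l :: w else [:: l].

Record free_group := FreeGroup { free_word : seq (A * bool); _ : reduced free_word }.

HB.instance Definition _ := [isSub for free_word].
HB.instance Definition _ := [Choice of free_group by <:].

Lemma letter_invK : involutive letter_inv.
Proof. by case=> a b; rewrite /letter_inv /= negbK. Qed.

Lemma push_reduced l w : reduced w -> reduced (push l w).
Proof.
case: w => [|m w] //= pw; case: eqVneq => [_|ne] /=; first exact: path_sorted pw.
by rewrite ne.
Qed.

Lemma pushK l w : reduced w -> push (letter_inv l) (push l w) = w.
Proof.
case: w => [|m w] /=; first by rewrite letter_invK eqxx.
case: eqVneq => [->|ne] /=; last by rewrite letter_invK eqxx.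
by case: w => [|m' w] //= /andP[/negPf ->].
Qed.

Lemma pushVK l w : reduced w -> push l (push (letter_inv l) w) = w.
Proof. by move=> rw; rewrite -{1}[l]letter_invK pushK. Qed.

Lemma foldr_push_reduced u v : reduced v -> reduced (foldr push v u).
Proof. by move=> rv; elim: u => //= l u; apply: push_reduced. Qed.

Lemma foldr_push_nil u : reduced u -> foldr push [::] u = u.
Proof.
elim: u => //= l u IHu pu; rewrite {}IHu; last exact: path_sorted pu.
by case: u pu => //= m u /andP[/negPf ->].
Qed.

Lemma foldr_push_push l u v :
  reduced u -> reduced v -> foldr push v (push l u) = push l (foldr push v u).
Proof.
case: u => //= m u pu rv; case: eqVneq => //= ->.
by rewrite pushVK // foldr_push_reduced.
Qed.

Lemma foldr_push_inv u v : reduced v ->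
  foldr push (foldr push v u) (rev (map letter_inv u)) = v.
Proof.
elim: u v => //= l u IHu v rv.
by rewrite rev_cons foldr_rcons pushK ?IHu // foldr_push_reduced.
Qed.

Lemma rev_inv_reduced u : reduced u -> reduced (rev (map letter_inv u)).
Proof.
rewrite /reduced rev_sorted sorted_map; apply: sub_sorted => l m /=.
by rewrite letter_invK eq_sym.
Qed.

Definition free_one : free_group := @FreeGroup [::] isT.
Definition free_inv (u : free_group) : free_group :=
  FreeGroup (rev_inv_reduced (valP u)).
Definition free_mul (u v : free_group) : free_group :=
  FreeGroup (foldr_push_reduced (val u) (valP v)).

Lemma free_mulA : associative free_mul.
Proof.
move=> [u ru] [v rv] [w rw]; apply: val_inj => /=.
by elim: u {ru} => //= l u ->; rewrite foldr_push_push // foldr_push_reduced.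
Qed.

Lemma free_mul1g : left_id free_one free_mul.
Proof. by move=> u; apply: val_inj. Qed.

Lemma free_mulg1 : right_id free_one free_mul.
Proof. by move=> u; apply: val_inj; apply: foldr_push_nil (valP u). Qed.

Lemma free_invK : involutive free_inv.
Proof.
move=> u; apply: val_inj; rewrite /= map_rev revK -map_comp map_id_in //.
by move=> l _; apply: letter_invK.
Qed.

Lemma free_mulVg : left_inverse free_one free_inv free_mul.
Proof.
move=> u; apply: val_inj => /=.
by rewrite -{1}[val u](foldr_push_nil (valP u)) foldr_push_inv.
Qed.

Lemma free_mulgV : right_inverse free_one free_inv free_mul.
Proof. by move=> u; rewrite -{1}[u]free_invK free_mulVg. Qed.

HB.instance Definition _ := isGroup.Build free_group
  free_mulA free_mul1g free_mulg1 free_mulVg free_mulgV.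

Definition free_gen (a : A) : free_group := @FreeGroup [:: (a, false)] isT.

Section Universal.
Variables (G : groupType) (g : A -> G).

Definition letter_eval l : G := if l.2 then (g l.1)^-1 else g l.1.

Definition word_eval (w : free_group) : G :=
  \prod_(l <- val w) letter_eval l.

Lemma letter_evalV l : letter_eval (letter_inv l) = (letter_eval l)^-1.
Proof. by case: l => a [] //=; rewrite /letter_eval /= invgK. Qed.

Lemma word_evalM : {morph word_eval : u v / u * v}.
Proof.
move=> [u ru] [v rv]; rewrite /word_eval /=.
elim: u {ru} => [|l u IHu] /=; first by rewrite big_nil mul1g.
rewrite big_cons -mulgA -IHu; case: (foldr push v u) => [|m w] /=.
  by rewrite big_seq1 big_nil mulg1.
case: eqVneq => [->|_]; last by rewrite big_cons.
by rewrite big_cons letter_evalV mulVKg.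
Qed.

Lemma word_eval_gen a : word_eval (free_gen a) = g a.
Proof. by rewrite /word_eval big_seq1. Qed.
End Universal.

Lemma free_group_ind (P : free_group -> Prop) :
    P 1 -> (forall a (u : free_group), P u -> P (free_gen a * u)) ->
    (forall a (u : free_group), P u -> P ((free_gen a)^-1 * u)) ->
  forall u : free_group, P u.
Proof.
move=> P1 Pg PV [u]; elim: u => [|[a b] u IHu] ru.
  by rewrite (_ : FreeGroup _ = 1) //; apply: val_inj.
have ru' : reduced u := path_sorted ru.
suff -> : @FreeGroup ((a, b) :: u) ru =
    (if b then (free_gen a)^-1 else free_gen a) * @FreeGroup u ru' .
  by case: (b); [apply: PV | apply: Pg].
apply: val_inj; case: b ru => /=; case: (u) => //= m w /andP[/negPf ne _];
  by rewrite ne.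
Qed.

Lemma free_groupP (G : groupType) (g : A -> G) :
  exists! phi : free_group -> G,
    {morph phi : u v / u * v} /\ forall a, phi (free_gen a) = g a.
Proof.
exists (word_eval g); split; first by split; [apply: word_evalM | apply: word_eval_gen].
move=> phi [phiM phig]; apply/funext => w.
have phi1 : phi 1 = 1 by apply: (mulgI (phi 1)); rewrite -phiM !mulg1.
elim/free_group_ind: w => [|a w IHw|a w IHw].
- by rewrite phi1 /word_eval big_nil.
- by rewrite word_evalM phiM IHw word_eval_gen phig.
- apply: (mulgI (g a)); rewrite -{1}(word_eval_gen g) -word_evalM mulVKg IHw.
  by rewrite -phig -phiM mulVKg.
Qed.

End FreeGroup.

(* G has a subgroup isomorphic to the free group on two generators *)
Definition contains_free2 (G : groupType) : Prop :=
  exists phi : {multiplicative free_group bool -> G}, injective phi.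

Section Amenable.
Local Open Scope ring_scope.
Local Open Scope classical_set_scope.

(* existence of a left-invariant finitely additive probability measure
   defined on all subsets *)
Definition amenable (R : realType) (G : groupType) : Prop :=
  exists mu : set G -> R,
    [/\ forall S, 0 <= mu S,
        mu setT = 1,
        forall S S', S `&` S' = set0 -> mu (S `|` S') = mu S + mu S' &
        forall g S, mu [set (g * x)%g | x in S] = mu S].

End Amenable.

Section TuringMachines.
Variables (d n k : nat).
Local Open Scope ring_scope.

Local Notation Zd := 'rV[int]_d.

Definition tapes : Type := Zd -> 'I_n.

Definition states : finType := {q : 'I_k.+1 | q != ord0}.

(* The symbol 0 marks the absence of the head. *)
Record heads := Heads {
  head_symbol :> Zd -> 'I_k.+1;
  head_unique : forall u v,
    head_symbol u != ord0 -> head_symbol v != ord0 -> u = v }.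

Definition configs : Type := (tapes * heads)%type.

Lemma single_head_subproof (v : Zd) (q : states) :
  let y t := if t == v then val q else ord0 in
  forall u w, y u != ord0 -> y w != ord0 -> u = w.
Proof. by move=> y u w; rewrite /y; case: (u =P v) => // ->; case: (w =P v). Qed.

Definition single_head (v : Zd) (q : states) : heads :=
  Heads (@single_head_subproof v q).

(* position and state of the head, or None if y is identically 0 *)
Definition find_head (y : heads) : option (Zd * states) :=
  match pselect (exists vq : Zd * states, y vq.1 = val vq.2) with
  | left h => Some (projT1 (cid h))
  | right _ => None
  end.

Definition local_rule (F F' : {fset Zd}) : Type :=
  {ffun F -> 'I_n} * states -> {ffun F' -> 'I_n} * states * Zd.

Definition read (F : {fset Zd}) (x : tapes) (v : Zd) : {ffun F -> 'I_n} :=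
  [ffun u => x (v + val u)].

Definition write (F' : {fset Zd}) (x : tapes) (v : Zd) (p : {ffun F' -> 'I_n})
  : tapes :=
  fun t => if insub (t - v) is Some u then p u else x t.

Definition tm_map (F F' : {fset Zd}) (f : local_rule F F') (c : configs)
  : configs :=
  if find_head c.2 is Some (v, q) then
    let: (p', q', e) := f (read F c.1 v, q) in
    (write c.1 v p', single_head (v + e) q')
  else c.

Definition turing_machine (T : configs -> configs) : Prop :=
  exists (F F' : {fset Zd}) (f : local_rule F F'), T = tm_map f.

Definition reversible (T : configs -> configs) : Prop :=
  turing_machine T /\
  exists S, [/\ turing_machine S, cancel T S & cancel S T].

Definition tape_preserving (T : configs -> configs) : Prop :=
  exists (F : {fset Zd}) (f : local_rule F F),
    (forall p q, (f (p, q)).1.1 = p) /\ T = tm_map f.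

Lemma find_headP (y : heads) :
  match find_head y with
  | Some (v, q) => y v = val q
  | None => forall v, y v = ord0
  end.
Proof.
rewrite /find_head; case: pselect => [h|nh]; first by case: (cid h) => -[].
move=> v; have [//|ne] := eqVneq (y v) ord0; case: nh.
by exists (v, exist _ (y v) ne).
Qed.

Lemma find_head_some (y : heads) (v : Zd) (q : states) :
  y v = val q -> find_head y = Some (v, q).
Proof.
move=> yv; have := find_headP y; case: (find_head y) => [[w r]|] /= yw.
  have ne (s : states) : val s != ord0 by case: s.
  have wv : w = v by apply: (head_unique (h := y)); [rewrite yw ne | rewrite yv ne].
  by move: yw; rewrite wv yv => /val_inj ->.
by move: (valP q); rewrite -yv yw eqxx.
Qed.

Lemma find_single_head v q : find_head (single_head v q) = Some (v, q).
Proof. by apply: find_head_some; rewrite /= eqxx. Qed.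

Lemma heads_inj (y z : heads) : y =1 z -> y = z.
Proof.
case: y z => [y Py] [z Pz] /= /funext yz; subst z.
by rewrite (Prop_irrelevance Py Pz).
Qed.

Lemma tm_map_nohead (F F' : {fset Zd}) (f : local_rule F F') (c : configs) :
  (forall v, c.2 v = ord0) -> tm_map f c = c.
Proof.
move=> c0; have := find_headP c.2; rewrite /tm_map.
by case: (find_head c.2) => [[v q]|//] cv; move: (valP q); rewrite -cv c0 eqxx.
Qed.

Lemma tm_map_head (F F' : {fset Zd}) (f : local_rule F F')
    (c : configs) v q p' q' e :
    c.2 v = val q -> f ([ffun u : F => c.1 (v + val u)], q) = (p', q', e) ->
  [/\ forall u : F', (tm_map f c).1 (v + val u) = p' u,
      forall t, t - v \notin F' -> (tm_map f c).1 t = c.1 t,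
      (tm_map f c).2 (v + e) = val q' &
      forall t, t != v + e -> (tm_map f c).2 t = ord0].
Proof.
move=> cv fE; rewrite /tm_map (find_head_some cv) /read fE /write /=; split.
- by move=> u; rewrite addrAC subrr add0r valK.
- by move=> t tF; rewrite insubN.
- by rewrite eqxx.
- by move=> t /negPf ->.
Qed.

(* a machine seen through its action on the whole tape, recentred at the head *)
Definition act_map (a : tapes -> states -> tapes * states * Zd) (c : configs)
  : configs :=
  if find_head c.2 is Some (v, q) then
    let b := a (fun t => c.1 (v + t)) q in
    ((fun t => b.1.1 (t - v)) : tapes, single_head (v + b.2) b.1.2)
  else c.

Definition local_act (H E : {fset Zd}) (a : tapes -> states -> tapes * states * Zd) :=
  [/\ forall x x' q, {in H, x =1 x'} ->
        [/\ {in H, (a x q).1.1 =1 (a x' q).1.1},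
            (a x q).1.2 = (a x' q).1.2 & (a x q).2 = (a x' q).2],
      forall x q t, t \notin H -> (a x q).1.1 t = x t &
      forall x q, (a x q).2 \in E].

Lemma tm_local_act T : turing_machine T ->
  exists H E a, local_act H E a /\ T = act_map a.
Proof.
move=> [F [F' [f ->]]].
pose a (x : tapes) q := let r := f (read F x 0, q) in
  (write x 0 r.1.1, r.1.2, r.2).
exists (F `|` F')%fset, [fset (f pq).2 | pq in predT]%fset, a; split.
  split.
  - move=> x x' q xx'.
    have rE : read F x 0 = read F x' 0.
      by apply/ffunP => u; rewrite !ffunE add0r xx' // in_fsetU (valP u).
    rewrite /a /= rE; split=> // t tH; rewrite /write.
    by case: insubP => // _; apply: xx'.
  - move=> x q t; rewrite in_fsetU negb_or => /andP[_ tF'].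
    by rewrite /a /= /write subr0 insubN.
  - by move=> x q; rewrite /a /=; apply: in_imfset.
apply/funext => -[x y]; rewrite /tm_map /act_map /=.
case: (find_head y) => [[v q]|//]; rewrite /a /=.
have -> : read F (fun t => x (v + t)) 0 = read F x v.
  by apply/ffunP => u; rewrite !ffunE add0r.
case: (f _) => -[p' q'] e /=; congr pair; apply/funext => t.
by rewrite /write subr0 [v + _]addrC subrK.
Qed.

End TuringMachines.

Lemma local_act_tm d n k H E (a : tapes d n -> states k -> _) :
  local_act H E a -> turing_machine (act_map a).
Proof.
case: n a => [|n] a [loc out _].
  exists fset0, fset0, (fun pq => (pq, 0%R)); apply/funext => -[x y].
  by case: (x 0%R) => m; rewrite ltn0.
pose ext (p : {ffun H -> 'I_n.+1}) : tapes d n.+1 :=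
  fun t => if insub t is Some u then p u else ord0.
exists H, H, (fun pq => let b := a (ext pq.1) pq.2 in
  ([ffun u => b.1.1 (val u)], b.1.2, b.2)).
apply/funext => -[x y]; rewrite /tm_map /act_map /=.
case: (find_head y) => [[v q]|//].
have [|e1 e2 e3] := loc (ext (read H x v)) (fun t => x (v + t)%R) q.
  by move=> t tH; rewrite /ext insubT /read ffunE.
rewrite e2 e3; congr pair; apply/funext => t; rewrite /write.
case: insubP => [u _ uE|tH]; first by rewrite ffunE uE e1 // -uE (valP u).
by rewrite out // [(v + _)%R]addrC subrK.
Qed.

Section Groups.
Variables (d n k : nat).
Local Open Scope ring_scope.
Local Notation Zd := 'rV[int]_d.
Local Notation configs := (configs d n k).

Lemma tm_comp (S T : configs -> configs) :
  turing_machine S -> turing_machine T -> turing_machine (S \o T).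
Proof.
move=> /tm_local_act[G [D [b [[locb outb movb] ->]]]].
move=> /tm_local_act[H [E [a [[loca outa mova] ->]]]].
pose c (x : tapes d n) (q : states k) := let r := a x q in
  let s := b (fun t => r.1.1 (r.2 + t)) r.1.2 in
  ((fun t => s.1.1 (t - r.2)) : tapes d n, s.1.2, r.2 + s.2).
have -> : act_map b \o act_map a = act_map c.
  apply/funext => -[x y]; rewrite /act_map /=.
  case Ey : (find_head y) => [[v q]|] /=; last by rewrite Ey.
  rewrite find_single_head /c /=; set r := a _ q.
  have -> : (fun t => r.1.1 (v + r.2 + t - v)) = (fun t => r.1.1 (r.2 + t)).
    by apply/funext => t; rewrite -[v + _ + t]addrA addrAC subrr add0r.
  rewrite addrA; congr pair; apply/funext => t.
  by rewrite opprD addrA.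
pose K := (H `|` [fset (e + g)%R | e in E, g in G])%fset.
apply: (@local_act_tm _ _ _ K [fset (e + g)%R | e in E, g in D]%fset); split.
- move=> x x' q xx'.
  have [|e1 e2 e3] := loca x x' q.
    by move=> t tH; apply: xx'; rewrite in_fsetU tH.
  have rE t : t \in K -> (a x q).1.1 t = (a x' q).1.1 t.
    move=> tK; have [/e1 //|tH] := boolP (t \in H).
    by rewrite !outa // xx'.
  have [|f1 f2 f3] := locb (fun t => (a x q).1.1 ((a x q).2 + t))
                           (fun t => (a x' q).1.1 ((a x q).2 + t)) (a x q).1.2.
    move=> t tG; rewrite rE // in_fsetU; apply/orP; right.
    by apply: in_imfset2.
  rewrite /c /= -e2 -e3 -f2 -f3; split=> // t tK.
  have [/f1 //|tG] := boolP (t - (a x q).2 \in G).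
  by rewrite !outb // addrC subrK rE.
- move=> x q t; rewrite in_fsetU negb_or => /andP[tH tG]; rewrite /c /=.
  rewrite outb; first by rewrite addrC subrK outa.
  apply: contra tG => tG; apply/imfset2P; exists (a x q).2; first exact: mova.
  by exists (t - (a x q).2) => //; rewrite addrC subrK.
- by move=> x q; apply: in_imfset2.
Qed.

Lemma tape_preserving_id : tape_preserving (@id configs).
Proof.
exists fset0, (fun pq => (pq, 0)); split=> //; apply/funext => -[x y].
have := find_headP y; rewrite /tm_map /=.
case: (find_head y) => [[v q]|] //= yv; congr pair.
  by apply/funext => t; rewrite /write insubN.
apply: heads_inj => t /=; rewrite addr0; case: eqP => [->//|tv].
apply/eqP/contraT => yt; case: tv; apply: (head_unique (h := y)) => //.
by rewrite yv; exact: (valP q).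
Qed.

Lemma tape_preservingP (T : configs -> configs) :
  tape_preserving T <-> turing_machine T /\ forall c, (T c).1 = c.1.
Proof.
split=> [[F [f [fp ->]]]|[[F [F' [f ->]]] fix1]].
  split; first by exists F, F, f.
  move=> [x y]; rewrite /tm_map /=; case: (find_head y) => [[v q]|] //=.
  have := fp (read F x v) q; case: (f _) => -[p' q'] e /= ->.
  apply/funext => t; rewrite /write; case: insubP => // u _ uE.
  by rewrite ffunE uE addrC subrK.
pose g : local_rule n k F F := fun pq => (pq.1, (f pq).1.2, (f pq).2).
exists F, g; split=> //; apply/funext => -[x y].
have := fix1 (x, y); rewrite /tm_map /=; case: (find_head y) => [[v q]|] //=.
case: (f _) => -[p' q'] e /= ->; congr pair.
apply/funext => t; rewrite /write; case: insubP => // u _ uE.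
by rewrite ffunE uE addrC subrK.
Qed.

Lemma reversible_id : reversible (@id configs).
Proof.
have [tm_id _] := (tape_preservingP id).1 tape_preserving_id.
by split=> //; exists id; split.
Qed.

Lemma reversible_comp (S T : configs -> configs) :
  reversible S -> reversible T -> reversible (S \o T).
Proof.
move=> [tmS [S' [tmS' SK S'K]]] [tmT [T' [tmT' TK T'K]]].
split; first exact: tm_comp.
exists (T' \o S'); split; [exact: tm_comp | exact: can_comp | exact: can_comp].
Qed.

(* The group law is composition of maps: S * T applies T first. *)
Record RTM := MakeRTM {
  RTM_map :> configs -> configs;
  _ : `[< reversible RTM_map >] }.

HB.instance Definition _ := [isSub for RTM_map].
HB.instance Definition _ := gen_eqMixin RTM.
HB.instance Definition _ := gen_choiceMixin RTM.

Lemma RTM_reversible (T : RTM) : reversible T.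
Proof. exact/asboolP/(valP T). Qed.

Lemma RTM_inv_subproof (T : RTM) :
  exists S : RTM, cancel T S /\ cancel S T.
Proof.
have [tmT [S [tmS TK SK]]] := RTM_reversible T.
have rS : `[< reversible S >] by apply/asboolP; split=> //; exists T.
by exists (MakeRTM rS).
Qed.

Definition RTM_one : RTM := MakeRTM (asboolT reversible_id).
Definition RTM_mul (S T : RTM) : RTM :=
  MakeRTM (asboolT (reversible_comp (RTM_reversible S) (RTM_reversible T))).
Definition RTM_inv (T : RTM) : RTM := projT1 (cid (RTM_inv_subproof T)).

Lemma RTM_mulA : associative RTM_mul.
Proof. by move=> S T U; apply: val_inj. Qed.
Lemma RTM_mul1g : left_id RTM_one RTM_mul.
Proof. by move=> T; apply: val_inj. Qed.
Lemma RTM_mulg1 : right_id RTM_one RTM_mul.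
Proof. by move=> T; apply: val_inj. Qed.
Lemma RTM_mulVg : left_inverse RTM_one RTM_inv RTM_mul.
Proof.
move=> T; apply/val_inj/funext => c; rewrite /RTM_inv /=.
by case: (cid _) => S [].
Qed.
Lemma RTM_mulgV : right_inverse RTM_one RTM_inv RTM_mul.
Proof.
move=> T; apply/val_inj/funext => c; rewrite /RTM_inv /=.
by case: (cid _) => S [].
Qed.

HB.instance Definition _ := isGroup.Build RTM
  RTM_mulA RTM_mul1g RTM_mulg1 RTM_mulVg RTM_mulgV.

Definition is_RFA : pred RTM := fun T => `[< tape_preserving T >].

Lemma is_RFA_group_closed : group_closed is_RFA.
Proof.
split; first exact/asboolP/tape_preserving_id.
move=> S T /asboolP/tape_preservingP[tmS S1] /asboolP/tape_preservingP[tmT T1].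
apply/asboolP/tape_preservingP; split; first exact: (RTM_reversible (S / T)%g).1.
move=> c; rewrite /= S1 -T1; congr (_ .1).
exact: (congr1 (fun U : RTM => U c) (mulgV T)).
Qed.

Record RFA := MakeRFA { RFA_RTM :> RTM; _ : is_RFA RFA_RTM }.

HB.instance Definition _ := [isSub for RFA_RTM].
HB.instance Definition _ := [Choice of RFA by <:].
HB.instance Definition _ :=
  SubChoice_isSubGroup.Build RTM is_RFA RFA is_RFA_group_closed.

End Groups.

(* Main.v *)
(** Fix a nonzero vector [e]. The position [v] starts a block when its symbol is
nonzero; the symbols at [v + e] and [v + 2e] (zero or not) then give the block
one of four colours. The machine [s_i] moves the head by [3e] across a block of
colour [i], in either direction, provided that neither the preceding nor the
following three positions form a block of colour [i]: this is an involution
whatever the tape. On a tape spelling a word without equal consecutive letters,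
the product of the corresponding involutions carries the head from one end of
the word to the other. So [s_1], ..., [s_4] generate their free product, in
which [s_1 s_2] and [s_3 s_4] generate a free group.

A group [G] containing a free group [F] maps [F]-equivariantly to [F], so a mean
on [G] would be inherited by [F], which is paradoxical. *)

From HB Require Import structures.
Require Import Defs.
From mathcomp Require Import all_boot all_algebra.
From mathcomp Require Import finmap zify lra.
From mathcomp Require Import boolp classical_sets reals.

Set Implicit Arguments.
Unset Strict Implicit.
Unset Printing Implicit Defensive.

Import GRing.Theory.

Local Open Scope group_scope.

(** * Free subgroups and invariant means *)

Section GroupMorphism.
Variables (G H : groupType) (f : {multiplicative G -> H}).

Lemma group_morph1 : f 1 = 1.
Proof. by apply: (mulgI (f 1)); rewrite -gmulfM !mulg1. Qed.

Lemma group_morphV : {morph f : x / x^-1}.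
Proof.
by move=> x; apply: (mulgI (f x)); rewrite -gmulfM !mulgV group_morph1.
Qed.

Lemma group_morph_inj : (forall x, f x = 1 -> x = 1) -> injective f.
Proof.
move=> ker1 x y fxy; apply/divg1_eq/ker1.
by rewrite gmulfM group_morphV fxy mulgV.
Qed.

Lemma contains_free2_trans :
  injective f -> contains_free2 G -> contains_free2 H.
Proof.
by move=> inj_f [phi inj_phi]; exists (f \o phi); apply: inj_comp.
Qed.

End GroupMorphism.

HB.instance Definition _ (A : choiceType) (G : groupType) (g : A -> G) :=
  isMultiplicative.Build (free_group A) G (word_eval g) (word_evalM g).

(** Left multiplication through [phi] is a free action of [F] on [G]. After choosing a point in each
    orbit, [r x] is the unique element of [F] carrying the chosen point to [x]. *)
Lemma equivariant_retraction (F G : groupType)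
    (phi : {multiplicative F -> G}) : injective phi ->
  exists r : G -> F, forall u x, r (phi u * x) = u * r x.
Proof.
move=> inj_phi; pose orb (x : G) : set G := fun y => exists u, x = phi u * y.
pose rep x := xget 1 (orb x).
have repP x : exists u, x = phi u * rep x.
  have : orb x (rep x).
    by apply: xgetPex; exists x; exists 1; rewrite group_morph1 mul1g.
  by [].
exists (fun x => projT1 (cid (repP x))) => v x.
(* Both points define the same orbit as a predicate, so [xget] chooses the same representative. *)
have rep_mul : rep (phi v * x) = rep x.
  congr (xget 1 _); apply/funext => y; apply/propext; split=> -[t].
    by move=> E; exists (v^-1 * t); rewrite gmulfM group_morphV -mulgA -E mulKg.
  by move=> ->; exists (v * t); rewrite gmulfM mulgA.
case: (cid (repP (phi v * x))) => u /= ux; case: (cid (repP x)) => w /= wx.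
apply/inj_phi/(mulIg (rep x)); rewrite gmulfM -mulgA -wx -rep_mul.
exact/esym.
Qed.

(** After a cancellation the remaining word cannot begin with [l], because the original was reduced.
    This drives the paradoxical decomposition of the free group. *)
Lemma ohead_push (A : choiceType) (l : A * bool) w : reduced w ->
  (ohead (push l w) == Some l) = (ohead w != Some (letter_inv l)).
Proof.
case: w => [|m w] /= rw; first by rewrite eqxx.
rewrite [Some m == _](inj_eq Some_inj); case: (eqVneq m) rw => [->|ne] /= rw.
  apply/negbTE; case: w rw => [|p w] //= /andP[].
  by rewrite letter_invK (inj_eq Some_inj).
by rewrite eqxx.
Qed.

Lemma contains_free2_not_amenable (R : realType) (G : groupType) :
  contains_free2 G -> ~ amenable R G.
Proof.
move=> [phi inj_phi] [mu [mu0 mu1 muU muM]].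
have [r rM] := equivariant_retraction inj_phi.
pose W l : set G := fun x => ohead (free_word (r x)) = Some l.
have muC S : (mu S + mu (~` S)%classic = 1)%R.
  by rewrite -muU ?setICr // setUv mu1.
(* Translation by [l] maps [W (letter_inv l)] onto the complement of [W l]. *)
have cover l : (mu (W l) + mu (W (letter_inv l)) = 1)%R.
  pose u : free_group bool := @FreeGroup _ [:: l] isT.
  rewrite -(muM (phi u) (W (letter_inv l))) -[RHS](muC (W l)).
  congr (_ + mu _)%R.
  apply/seteqP; split=> x /=.
    case=> y Wy <-; rewrite /W rM /=; apply/eqP.
    by rewrite ohead_push ?Wy ?eqxx //; case: (r y).
  move=> /eqP nWx; exists (phi u^-1 * x); last first.
    by rewrite mulgA -gmulfM mulgV group_morph1 mul1g.
  rewrite /W rM; apply/eqP; rewrite /= ohead_push ?letter_invK //.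
  by case: (r x).
have WI l m : l != m -> (W l `&` W m)%classic = set0.
  move=> ne; apply/seteqP; split=> // x [Wl Wm]; case/eqP: ne.
  by apply: Some_inj; rewrite -Wl -Wm.
pose W2 a := (W (a, false) `|` W (a, true))%classic.
have muW2 a : mu (W2 a) = 1%R.
  by rewrite /W2 muU ?WI ?xpair_eqE ?andbF //; exact: (cover (a, false)).
(* Each generator accounts for mass 1, and the two sets are disjoint: total mass 2. *)
have : (mu (W2 false `|` W2 true)%classic = 1 + 1)%R.
  by rewrite muU ?muW2 // /W2 setIUl !setIUr !WI // !setU0.
have := muC (W2 false `|` W2 true)%classic.
have := mu0 (~` (W2 false `|` W2 true))%classic.
by lra.
Qed.

(** * Crossing an isolated edge *)

Section Hop.
Local Open Scope ring_scope.
Variables (V : zmodType) (E : pred V) (s : V).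

Definition hop (v : V) : V :=
  if [&& E v, ~~ E (v - s) & ~~ E (v + s)] then s
  else if [&& E (v - s), ~~ E v & ~~ E (v - s - s)] then - s
  else 0.

(** Read [E v] as marking the edge from [v] to [v + s]. Both ends of an edge apply the same test,
    that it is marked and its two neighbours are not, so a crossing is undone by the next one. *)
Lemma hopK : involutive (fun v => v + hop v).
Proof.
move=> v /=; move hE: (hop v) => h; move: hE; rewrite {1}/hop.
case: ifP => [/and3P[Ev nEl nEr] <-|nright].
  by rewrite /hop addrK Ev nEl (negbTE nEr) /= addrK.
case: ifP => [/and3P[El nEv nEl'] <-|nleft <-].
  by rewrite /hop El nEl' subrK nEv subrK.
by rewrite /hop !addr0 nright nleft addr0.
Qed.

End Hop.

(** * The four involutive machines *)

Section Machines.
Local Open Scope ring_scope.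
Variables (d n k : nat).
Local Notation Zd := 'rV[int]_d.
Local Notation tapes := (tapes d n).

(** The vector [e] is the all-ones vector, so its multiples are the constant vectors. *)
Definition coloured (i : bool * bool) (x : tapes) (u : Zd) : bool :=
  [&& 0 < x u, (0 < x (u + const_mx 1)%R) == i.1
    & (0 < x (u + const_mx 2)%R) == i.2]%N.

Definition flip_act i (x : tapes) (q : states k) : tapes * states k * Zd :=
  (x, q, hop (coloured i x) (const_mx 3) 0).

Definition flip i : configs d n k -> configs d n k := act_map (flip_act i).

Lemma flip_single i x v q :
  flip i (x, single_head v q) =
  (x, single_head (v + hop (coloured i x) (const_mx 3) v) q).
Proof.
rewrite /flip /act_map find_single_head /=; congr (_, single_head (v + _) q).
  by apply/funext => t; rewrite [v + _]addrC subrK.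
by rewrite /hop /coloured !addrA addr0.
Qed.

Lemma headsP (y : heads d k) :
  (forall v, y v = ord0) \/ exists v q, y = single_head v q.
Proof.
have := find_headP y; case: (find_head y) => [[v q]|]; last by left.
move=> yv; right; exists v, q; apply: heads_inj => t /=.
case: eqP => [->//|tv]; apply/eqP/contraT => yt; case: tv.
by apply: (head_unique (h := y)) => //; rewrite yv; exact: (valP q).
Qed.

Lemma flip_tm i : turing_machine (flip i).
Proof.
pose s : Zd := const_mx 3.
(* [hop] at [0] tests four blocks of three cells; the sums keep the shape they have when [hop] is
   unfolded. *)
pose H := [fset (u + w)%R | u in [:: 0; 0 - s; 0 + s; 0 - s - s]%R,
                            w in [:: 0; const_mx 1; const_mx 2]%R]%fset.
apply: (@local_act_tm _ _ _ H [fset 0%R; s; (- s)%R]%fset); split=> //.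
  move=> x x' q xx'; split=> //; rewrite /flip_act /=.
  have col u : u \in [:: 0; 0 - s; 0 + s; 0 - s - s] ->
      coloured i x u = coloured i x' u.
    move=> uH.
    have xw w : w \in [:: 0; const_mx 1; const_mx 2] -> x (u + w) = x' (u + w).
      by move=> ?; apply: xx'; apply: in_imfset2.
    have x0 := xw 0; rewrite addr0 in x0.
    have x1 := xw (const_mx 1); have x2 := xw (const_mx 2).
    by rewrite /coloured x0 ?x1 ?x2 ?inE ?eqxx ?orbT.
  by rewrite /hop !col // !inE eqxx ?orbT.
move=> x q; rewrite /flip_act /hop /= !inE.
by case: ifP => _; [|case: ifP => _]; rewrite eqxx ?orbT.
Qed.

Lemma flipK i : involutive (flip i).
Proof.
move=> [x y]; have [y0|[v [q ->]]] := headsP y; last first.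
  by rewrite !flip_single (hopK (coloured i x) (const_mx 3)).
have [F [F' [f ->]]] := flip_tm i.
by rewrite !(@tm_map_nohead _ _ _ _ _ _ (x, y)).
Qed.

Lemma flip_reversible i : reversible (flip i).
Proof.
split; first exact: flip_tm.
by exists (flip i); split; [apply: flip_tm | apply: flipK | apply: flipK].
Qed.

Lemma flip_tape_preserving i : tape_preserving (flip i).
Proof.
apply/tape_preservingP; split=> [|[x y]]; first exact: flip_tm.
have [y0|[v [q ->]]] := headsP y; last by rewrite flip_single.
by have [F [F' [f ->]]] := flip_tm i; rewrite tm_map_nohead.
Qed.

Definition flip_RFA i : RFA d n k :=
  @MakeRFA d n k (MakeRTM (asboolT (flip_reversible i)))
    (asboolT (flip_tape_preserving i)).

End Machines.

(** * Tapes that spell words *)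

Section Words.
Local Open Scope ring_scope.
Variables (d n k : nat) (hn : (1 < n)%N) (hd : (0 < d)%N) (q : states k).
Implicit Types (i : bool * bool) (w : seq (bool * bool)).

Definition bit (b : bool) : 'I_n := Ordinal (leq_ltn_trans (leq_b1 b) hn).

(** Only the first coordinate is read, which determines a position on the diagonal. The start symbol
    is zero past the end of [w], so the default letter of [nth] creates no block. *)
Definition spell w : tapes d n := fun t =>
  if t ord0 (Ordinal hd) is Posz m then
    let i := nth (false, false) w (m %/ 3) in
    bit (match m %% 3 with 0 => m %/ 3 < size w | 1 => i.1 | _ => i.2 end)%N
  else bit false.

Lemma coloured_spell i w (m : int) :
  coloured i (spell w) (const_mx (m * 3)) =
  if m is Posz j then (j < size w)%N && (nth (false, false) w j == i)
  else false.
Proof.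
have bitE b : (0 < bit b)%N = b by case: b.
rewrite /coloured /spell !mxE; case: m => j.
  have -> : Posz j * 3 = Posz (j * 3) by lia.
  rewrite -!PoszD !divnMDl // !modnMDl mulnK // modnMl !addn0 !bitE.
  by congr (_ && _); case: (nth _ _ _) i => a b [a' b'].
by have -> : Negz j * 3 = Negz (j * 3 + 2) by lia.
Qed.

(** The head stands at the right end of the block of [i]. The neighbouring blocks spell letters
    other than [i] or fall outside the word, so the edge is isolated. *)
Lemma hop_spell i w1 w2 :
  sorted (fun i j => i != j) (w1 ++ i :: w2) ->
  hop (coloured i (spell (w1 ++ i :: w2))) (const_mx 3)
    (const_mx ((size w1).+1%:Z * 3)) = - const_mx 3.
Proof.
move=> sw; have subE m : const_mx (m * 3) - const_mx 3 =
    const_mx ((m - 1) * 3) :> 'rV[int]_d.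
  by apply/matrixP => a b; rewrite !mxE; lia.
rewrite /hop !subE !coloured_spell.
have -> : (size w1).+1%:Z - 1 = size w1 by lia.
rewrite !nth_cat ltnn subnn /= eqxx size_cat /= addnS ltnS leq_addr /=.
rewrite [(_.+1 < size w1)%N]ltnNge leqnSn subSnn /=.
have /negPf -> : ~~ ((size w1 < size w1 + size w2)%N
    && (nth (false, false) w2 0 == i)).
  case: w2 sw => [|j w2] /cat_sorted2[_]; first by rewrite addn0 ltnn.
  by case/andP=> /= ne _; rewrite eq_sym (negPf ne) andbF.
rewrite andbF /=; case/lastP: w1 sw => [//|w1 j].
rewrite size_rcons cat_rcons => /cat_sorted2[_ /andP[/negPf ne _]].
have -> : (size w1).+1%:Z - 1 = size w1 by lia.
by rewrite nth_cat ltnn subnn /= ne andbF.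
Qed.

(* Products apply their last factor first, so the head goes from right to left. *)
Lemma prod_flip_RFA w1 w2 : sorted (fun i j => i != j) (w1 ++ w2) ->
  (\prod_(i <- w2) flip_RFA d n k i)%g
    (spell (w1 ++ w2), single_head (const_mx ((size (w1 ++ w2))%:Z * 3)) q) =
  (spell (w1 ++ w2), single_head (const_mx ((size w1)%:Z * 3)) q).
Proof.
elim: w2 w1 => [|i w2 IHw] w1 sw; first by rewrite big_nil cats0.
rewrite big_cons /=.
(* The factors from [w2] act first and stop at the right end of the block of [i]. *)
have := IHw (rcons w1 i); rewrite cat_rcons => /(_ sw) ->.
rewrite flip_single size_rcons hop_spell //; congr (_, single_head _ _).
by apply/matrixP => a b; rewrite !mxE; lia.
Qed.

Definition flip_pair (a : bool) : RFA d n k :=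
  (flip_RFA d n k (a, false) * flip_RFA d n k (a, true))%g.

(** Inverting a product of two involutions swaps them, so this lists the factors for a letter of
    either sign. *)
Definition expand (l : bool * bool) := [:: l; (l.1, ~~ l.2)].

Lemma flip_RFAV i : ((flip_RFA d n k i)^-1 = flip_RFA d n k i)%g.
Proof.
apply: (mulgI (flip_RFA d n k i)); rewrite mulgV; apply/esym.
apply/val_inj/val_inj/funext => c; exact: flipK.
Qed.

Lemma word_eval_flip_pair (u : free_group bool) :
  word_eval flip_pair u =
  (\prod_(i <- flatten (map expand (free_word u))) flip_RFA d n k i)%g.
Proof.
rewrite /word_eval big_flatten big_map; apply: eq_bigr => -[a b] _.
rewrite !big_cons big_nil /= mulg1 /letter_eval /flip_pair /=.
by case: b; rewrite ?invgM ?flip_RFAV.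
Qed.

(** Inside a pair the second bits differ; where two pairs meet, the condition is exactly that
    consecutive letters do not cancel. *)
Lemma sorted_expand w :
  reduced w -> sorted (fun i j => i != j) (flatten (map expand w)).
Proof.
elim: w => //= -[a b] w IHw rw.
have -> : (a, b) != (a, ~~ b) by rewrite xpair_eqE eqxx; case: (b).
have := IHw (path_sorted rw).
by case: w rw {IHw} => //= m w /andP[ne _] ->; rewrite eq_sym ne.
Qed.

Lemma contains_free2_RFA : contains_free2 (RFA d n k).
Proof.
exists (word_eval flip_pair); apply: group_morph_inj => u /=.
rewrite word_eval_flip_pair; set w := flatten _ => prod1.
have sw : sorted (fun i j => i != j) w by apply/sorted_expand/(valP u).
(* On the tape spelling [w] the head goes from [3 * size w] to [0]; a trivial action thus forces
   [w], and hence [u], to be empty. *)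
have := @prod_flip_RFA [::] w sw; rewrite prod1 /= => /(congr1 snd) /=.
move=> /(congr1 (fun y : heads d k => find_head y)); rewrite !find_single_head.
move=> [] /matrixP/(_ ord0 (Ordinal hd)); rewrite !mxE => w0.
have {w0} : size w = 0 by lia.
rewrite /w; case: u {w sw prod1} => -[|//] ? /= _; exact: val_inj.
Qed.

End Words.

Theorem corollary3 (R : realType) (d n k : nat)
  (hn : (2 <= n)%N) (hk : (1 <= k)%N) (hd : (1 <= d)%N) :
  [/\ contains_free2 (RFA d n k), contains_free2 (RTM d n k),
      ~ amenable R (RFA d n k) & ~ amenable R (RTM d n k)].
Proof.
(* The symbol [k] is a genuine state because [k] is positive. *)
have q : states k by exists ord_max; rewrite -val_eqE /= -lt0n.
have freeRFA := contains_free2_RFA hn hd q.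
have freeRTM : contains_free2 (RTM d n k).
  pose f : {multiplicative RFA d n k -> RTM d n k} := val.
  by apply: (contains_free2_trans (f := f)) => //; apply: val_inj.
by split=> //; apply: contains_free2_not_amenable.
Qed.
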